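(* Define square integer matrices $X_k$ and $O_k$ of size $2^k\times 2^k$ recursively by the $1\times 1$ matrices $X_0=\begin{bmatrix}1\end{bmatrix}$, $O_0=\begin{bmatrix}1\end{bmatrix}$ and, for $k\ge 0$, the block matrices $$X_{k+1}=\begin{bmatrix} X_k & O_k\\ O_k & X_k\end{bmatrix},\qquad O_{k+1}=\begin{bmatrix} O_k & X_k\\ X_k & 4\,O_k\end{bmatrix}.$$ For all integers $m,n\ge 2$, the total number $D^{(m,n)}$ of knot $(m,n)$-mosaics is $$D^{(m,n)}=2\,\bigl\|(X_{m-2}+O_{m-2})^{n-2}\bigr\|,$$ where $\|N\|$ denotes the sum of all entries of a matrix $N$, and for $n=2$ the power $(X_{m-2}+O_{m-2})^0$ means the identity matrix of size $2^{m-2}\times 2^{m-2}$.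
   Context: Mosaic tiles: there are eleven mosaic tiles $T_0,\dots,T_{10}$, each a unit square with curves drawn on it whose endpoints are midpoints of edges of the square. A connection point of a tile is the midpoint of an edge of the tile that is an endpoint of a curve drawn on the tile. The tiles have the following connection points: $T_0$ (empty tile): none; $T_1$: left and bottom; $T_2$: right and bottom; $T_3$: right and top; $T_4$: left and top; $T_5$: left and right; $T_6$: top and bottom; $T_7,T_8,T_9,T_{10}$: all four edges. (Each of $T_1,\dots,T_6$ carries one arc joining its two connection points; $T_7,T_8$ are the two tiles carrying two disjoint arcs, and $T_9,T_{10}$ are the two crossing tiles. The eleven tiles are pairwise distinct, and $T_7,\dots,T_{10}$ are four distinct tiles with the same set of connection points.) For positive integers $m,n$, an $(m,n)$-mosaic is an $m\times n$ matrix $M=(M_{ij})$ of mosaic tiles, with the tiles placed in an $m\times n$ rectangular array ($m$ rows, $n$ columns). Two tiles are contiguous if they lie immediately next to each other in the same row or the same column. A mosaic is suitably connected if for any pair of contiguous tiles, either both or neither of them have a connection point on their common edge. A knot $(m,n)$-mosaic is a suitably connected $(m,n)$-mosaic in which no tile has a connection point on an edge lying on the boundary of the rectangular array. $D^{(m,n)}$ denotes the number of all knot $(m,n)$-mosaics (counted as matrices of tiles). *)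

(* Defs.v *)
From HB Require Import structures.
From mathcomp Require Import all_boot all_order all_algebra.

Set Implicit Arguments.
Unset Strict Implicit.
Unset Printing Implicit Defensive.

Import GRing.Theory.
Local Open Scope ring_scope.

(* T7, T8 carry the two pairs of disjoint arcs, T9, T10 the two crossings; only
   their distinctness and their connection points matter for the count. *)
Inductive tile := T0 | T1 | T2 | T3 | T4 | T5 | T6 | T7 | T8 | T9 | T10.

Definition ord_of_tile (t : tile) : 'I_11 :=
  inord match t with
        | T0 => 0 | T1 => 1 | T2 => 2 | T3 => 3 | T4 => 4 | T5 => 5
        | T6 => 6 | T7 => 7 | T8 => 8 | T9 => 9 | T10 => 10
        end.

Definition tile_of_ord (i : 'I_11) : tile :=
  nth T0 [:: T0; T1; T2; T3; T4; T5; T6; T7; T8; T9; T10] i.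

Lemma ord_of_tileK : cancel ord_of_tile tile_of_ord.
Proof. by case; rewrite /tile_of_ord inordK. Qed.

HB.instance Definition _ := Finite.copy tile (can_type ord_of_tileK).

Inductive edge := Left | Right | Top | Bottom.

(* Whether the midpoint of the edge e is a connection point of the tile t. *)
Definition conn (t : tile) (e : edge) : bool :=
  match t, e with
  | T0, _ => false
  | T1, (Left | Bottom) => true
  | T2, (Right | Bottom) => true
  | T3, (Right | Top) => true
  | T4, (Left | Top) => true
  | T5, (Left | Right) => true
  | T6, (Top | Bottom) => true
  | (T7 | T8 | T9 | T10), _ => true
  | _, _ => false
  end.

(* Row 0 is the top row and column 0 the leftmost column. *)
Definition suitably_connected m n (M : 'M[tile]_(m, n)) : bool :=
  [forall i : 'I_m, forall j : 'I_n, forall j' : 'I_n,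
     (j' == j.+1 :> nat) ==> (conn (M i j) Right == conn (M i j') Left)]
  && [forall i : 'I_m, forall i' : 'I_m, forall j : 'I_n,
     (i' == i.+1 :> nat) ==> (conn (M i j) Bottom == conn (M i' j) Top)].

Definition boundary_free m n (M : 'M[tile]_(m, n)) : bool :=
  [forall i : 'I_m, forall j : 'I_n,
     [&& (i == 0 :> nat) ==> ~~ conn (M i j) Top,
         (i.+1 == m) ==> ~~ conn (M i j) Bottom,
         (j == 0 :> nat) ==> ~~ conn (M i j) Left
       & (j.+1 == n) ==> ~~ conn (M i j) Right]].

Definition knot_mosaic m n (M : 'M[tile]_(m, n)) : bool :=
  suitably_connected M && boundary_free M.

Definition D (m n : nat) : nat := #|[set M : 'M[tile]_(m, n) | knot_mosaic M]|.

Lemma addnn_expn2 k : (2 ^ k + 2 ^ k = 2 ^ k.+1)%N.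
Proof. by rewrite addnn -mul2n expnS. Qed.

(* The cast only identifies the dimension 2 ^ k + 2 ^ k with 2 ^ k.+1. *)
Definition block2 k (A B C E : 'M[int]_(2 ^ k)) : 'M[int]_(2 ^ k.+1) :=
  castmx (addnn_expn2 k, addnn_expn2 k) (block_mx A B C E).

Fixpoint Xmx (k : nat) : 'M[int]_(2 ^ k) :=
  match k with
  | 0 => const_mx 1
  | k'.+1 => block2 (Xmx k') (Omx k') (Omx k') (Xmx k')
  end
with Omx (k : nat) : 'M[int]_(2 ^ k) :=
  match k with
  | 0 => const_mx 1
  | k'.+1 => block2 (Omx k') (Xmx k') (Xmx k') (4 *: Omx k')
  end.

Definition entry_sum p q (N : 'M[int]_(p, q)) : int := \sum_i \sum_j N i j.

(* Main.v *)
Require Import Defs.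
From HB Require Import structures.
From mathcomp Require Import all_boot all_order all_algebra.

Import GRing.Theory.
Local Open Scope ring_scope.

(** The count is done by transfer matrices, one column of tiles at a time.
    Record which edges along a vertical grid line carry a connection
    point: this is a state, a word of booleans. Every tile has an even
    number of connection points; each even set of edges other than the full
    one comes from exactly one tile, and the full one from four tiles. Hence
    a column whose left state, right state and top edge are prescribed has
    its bottom edge forced by parity, and the number of such columns is a
    product of factors 1 and 4 ([column_weight], [column_count]). Splitting
    a column at its first tile gives exactly the recursion that defines
    [Xmx] (top edge without connection point) and [Omx] (top edge with one),
    see [Xmx_Omx_entries]. So for [p], [q] positive, the entries of
    [(Xmx p + Omx p) ^+ q] add up to the number of suitably connected arrays with
    [p] rows and [q] columns whose outer boundary is unrestricted.

    It remains to see why the outermost layer of tiles contributes the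
    factor 2. In a knot mosaic all states are even, since the columns have
    no connection point on their top and bottom edges ([mosaic_count_odd]).
    Write an even state as [x :: rcons a z]: the bit [z] is determined by
    [x] and [a]. No tile of the top or bottom row has four connection
    points, so these tiles have weight 1, and the column between the even
    states with data [(x, a)] and [(y, b)] has the weight of its inner part,
    whose top edge is [x (+) y] ([column_weight_even]). Summing over [y]
    gives the entry of [Xmx p + Omx p] at [(a, b)], whatever [x] is
    ([mosaic_count_even]). The first and last columns have weight 1 for
    every even state, so [D p.+2 q.+2] is the sum, over the bit [x] and the
    inner state [a], of a quantity that does not depend on [x]
    ([D_inner_count]). *)

Set Implicit Arguments.
Unset Strict Implicit.
Unset Printing Implicit Defensive.

Local Open Scope nat_scope.

(** * Sums over tuples *)

Lemma big_pair_bij (A B C : finType) (h : A * B -> C) (F : C -> nat) :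
  injective h -> #|C| = #|A| * #|B| ->
  \sum_c F c = \sum_a \sum_b F (h (a, b)).
Proof.
move=> h_inj cardC.
have h_bij : bijective h by apply: inj_card_bij; rewrite // card_prod cardC.
rewrite (reindex h) /=; last exact: onW_bij.
by rewrite pair_big /=; apply: eq_bigr => -[a b].
Qed.

Lemma big_tuple_cons (T : finType) n (F : n.+1.-tuple T -> nat) :
  \sum_t F t = \sum_x \sum_(t : n.-tuple T) F [tuple of x :: t].
Proof.
apply: (big_pair_bij (h := fun p : T * n.-tuple T => [tuple of p.1 :: p.2])).
  by move=> [x t] [y u] /(congr1 val) [/= -> /val_inj ->].
by rewrite !card_tuple expnS.
Qed.

Lemma big_tuple_rcons (T : finType) n (F : n.+1.-tuple T -> nat) :
  \sum_t F t = \sum_(t : n.-tuple T) \sum_x F [tuple of rcons t x].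
Proof.
rewrite exchange_big.
apply: (big_pair_bij (h := fun p : T * n.-tuple T => [tuple of rcons p.2 p.1])).
  by move=> [x t] [y u] /(congr1 val) /= /rcons_inj [/val_inj -> ->].
by rewrite !card_tuple expnS.
Qed.

Lemma big_tuple0 (T : finType) (F : 0.-tuple T -> nat) :
  \sum_t F t = F [tuple].
Proof.
by rewrite (big_pred1 [tuple]) // => t /=; apply/esym/eqP; apply: tuple0.
Qed.

(** * Chains of tiles *)
Section Chain.
Variables (T : Type) (S : eqType) (inp out : T -> S).

(** A word [w] of items, each with an entry and an exit value, is chained from
    [s] to [e] when its first entry is [s], its last exit is [e], and each exit
    is the next entry. If [w] is empty, this means [s = e]. *)
Definition chained (s : S) (w : seq T) (e : S) : bool :=
  s :: map out w == rcons (map inp w) e.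

Lemma chained_nil s e : chained s [::] e = (s == e).
Proof. by rewrite /chained /= eqseq_cons eqxx andbT. Qed.

Lemma chained_cons s x w e :
  chained s (x :: w) e = (inp x == s) && chained (out x) w e.
Proof. by rewrite /chained /= eqseq_cons eq_sym. Qed.

Lemma chained_ordP n (f : 'I_n -> T) s e : 0 < n ->
  reflect [/\ forall j : 'I_n, j = 0 :> nat -> inp (f j) = s,
              forall j : 'I_n, j.+1 = n -> out (f j) = e
            & forall j j' : 'I_n, j' = j.+1 :> nat -> out (f j) = inp (f j')]
          (chained s [tuple f j | j < n] e).
Proof.
case: n f => // n f _; rewrite /chained.
have nth_out (j : 'I_n.+1) :
  nth s (map out [tuple f j | j < n.+1]) j = out (f j).
  rewrite -map_comp (nth_map ord0) ?size_enum_ord //=.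
  by rewrite nth_ord_enum.
have nth_inp (j : 'I_n.+1) :
  nth s (map inp [tuple f j | j < n.+1]) j = inp (f j).
  rewrite -map_comp (nth_map ord0) ?size_enum_ord //=.
  by rewrite nth_ord_enum.
set wo := map out _ in nth_out *; set wi := map inp _ in nth_inp *.
have so : size wo = n.+1 by rewrite size_map size_tuple.
have si : size wi = n.+1 by rewrite size_map size_tuple.
apply: (iffP eqP) => [E | [E0 En Em]].
  have nE k : nth s (s :: wo) k = nth s (rcons wi e) k by rewrite E.
  split=> [j j0 | j jn | j j' jj'].
  - by have := nE j; rewrite nth_rcons si ltn_ord nth_inp j0.
  - by have := nE j.+1; rewrite nth_rcons si jn ltnn eqxx -jn /= nth_out.
  - by have := nE j'; rewrite nth_rcons si ltn_ord nth_inp jj' /= nth_out.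
apply: (@eq_from_nth _ s); first by rewrite size_rcons /= so si.
rewrite /= so => k; rewrite ltnS nth_rcons si => le_kn.
case: ltngtP le_kn => // [lt_kn | ->] _; last first.
  by have := nth_out ord_max; rewrite /= => ->; apply: En.
have:= nth_inp (Ordinal lt_kn); rewrite /= => ->.
case: k lt_kn => [|k] lt_kn /=; first by rewrite E0.
have:= nth_out (Ordinal (ltnW lt_kn)); rewrite /= => ->.
exact: Em.
Qed.

End Chain.

(** A column of tiles is listed from top to bottom; its left and right states
    list the connection points on its left and right edges. *)
Definition left_conn (c : seq tile) : seq bool := map (conn^~ Left) c.
Definition right_conn (c : seq tile) : seq bool := map (conn^~ Right) c.

(** The tiles of a column fit together, with prescribed connections on its top
    and bottom edges. *)
Definition vchained : bool -> seq tile -> bool -> bool :=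
  chained (conn^~ Top) (conn^~ Bottom).

(** The columns, listed from left to right, fit together, with prescribed left
    and right boundary states. *)
Definition hchained : seq bool -> seq (seq tile) -> seq bool -> bool :=
  chained left_conn right_conn.

(** A mosaic as the word of its columns. *)
Definition column_mosaic m n (M : 'M[tile]_(m, n)) : n.-tuple (m.-tuple tile) :=
  [tuple [tuple M i j | i < m] | j < n].

Lemma column_mosaic_bij m n : bijective (@column_mosaic m n).
Proof.
exists (fun cs => \matrix_(i, j) tnth (tnth cs j) i) => [M | cs].
  by apply/matrixP => i j; rewrite mxE !tnth_mktuple.
by apply/eq_from_tnth => j; apply/eq_from_tnth => i; rewrite !tnth_mktuple mxE.
Qed.

Lemma knot_mosaic_chained m n (M : 'M[tile]_(m, n)) : 0 < m -> 0 < n ->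
  knot_mosaic M =
  all (fun c : m.-tuple tile => vchained false c false) (column_mosaic M)
  && hchained (nseq m false) (map val (column_mosaic M)) (nseq m false).
Proof.
move=> m0 n0; rewrite /hchained -map_comp /= all_map.
rewrite -[map _ (enum 'I_n)]/(val [tuple val [tuple M i j | i < m] | j < n]).
have left_col j : left_conn [tuple M i j | i < m] =
  [seq conn (M i j) Left | i <- enum 'I_m].
  by rewrite /left_conn -map_comp.
have right_col j : right_conn [tuple M i j | i < m] =
  [seq conn (M i j) Right | i <- enum 'I_m].
  by rewrite /right_conn -map_comp.
have zero_col : nseq m false = [seq false | i <- enum 'I_m].
  have const (u : seq 'I_m) : [seq false | _ <- u] = nseq (size u) false.
    by elim: u => //= _ u ->.
  by rewrite const size_enum_ord.
apply/idP/idP.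
- case/andP => /andP[/forallP Hh /forallP Hv] /forallP Hb.
  have bnd i j := forallP (Hb i) j.
  apply/andP; split.
    apply/allP => j _ /=; apply/(chained_ordP _ _ _ _ _ m0); split.
    + by move=> i /eqP i0; have /and4P[/implyP/(_ i0)/negPf] := bnd i j.
    + by move=> i /eqP im; have /and4P[_ /implyP/(_ im)/negPf] := bnd i j.
    + move=> i i' /eqP ii'.
      by have /implyP/(_ ii')/eqP := forallP (forallP (Hv i) i') j.
  apply/(chained_ordP _ _ _ _ _ n0); split.
  + move=> j /eqP j0; rewrite left_col zero_col; apply: eq_map => i.
    by have /and4P[_ _ /implyP/(_ j0)/negPf] := bnd i j.
  + move=> j /eqP jn; rewrite right_col zero_col; apply: eq_map => i.
    by have /and4P[_ _ _ /implyP/(_ jn)/negPf] := bnd i j.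
  + move=> j j' /eqP jj'; rewrite left_col right_col; apply: eq_map => i.
    by have /implyP/(_ jj')/eqP := forallP (forallP (Hh i) j) j'.
- case/andP => /allP Hc /(chained_ordP _ _ _ _ _ n0) [H0 Hn Hm].
  have {}Hc j := elimT (chained_ordP _ _ _ _ _ m0) (Hc j (mem_enum _ j)).
  have ext (f g : 'I_m -> bool) :
    [seq f i | i <- enum 'I_m] = [seq g i | i <- enum 'I_m] -> f =1 g.
    by move=> /eq_in_map E i; apply: E; rewrite mem_enum.
  apply/andP; split; first (apply/andP; split).
  + apply/forallP => i; apply/forallP => j; apply/forallP => j'.
    apply/implyP => /eqP /Hm; rewrite left_col right_col => /ext E.
    by rewrite (E i).
  + apply/forallP => i; apply/forallP => i'; apply/forallP => j.
    by apply/implyP => /eqP; have [_ _ E] := Hc j => /E ->.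
  + apply/forallP => i; apply/forallP => j; have [C0 Cm _] := Hc j.
    apply/and4P; split; apply/implyP => /eqP.
    * by move=> /C0 ->.
    * by move=> /Cm ->.
    * by move=> /H0; rewrite left_col zero_col => /ext/(_ i) ->.
    * by move=> /Hn; rewrite right_col zero_col => /ext/(_ i) ->.
Qed.

(** * Counting columns *)

(** The number of tiles with connections [t], [x], [y] on the top, left and
    right edges; the fourth connection is then [t (+) x (+) y]. *)
Definition tile_weight (t x y : bool) : nat := if [&& t, x & y] then 4 else 1.

(** The number of columns with left state [a], right state [b] (of the same
    length) and connection [t] on the top edge, the bottom edge being free. *)
Fixpoint column_weight (t : bool) (a b : seq bool) : nat :=
  match a, b with
  | x :: a', y :: b' => tile_weight t x y * column_weight (t (+) x (+) y) a' b'
  | _, _ => 1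
  end.

Definition parity (a : seq bool) : bool := foldr addb false a.

Lemma big_tile (F : tile -> nat) :
  \sum_t F t =
  F T0 + (F T1 + (F T2 + (F T3 + (F T4 + (F T5 +
  (F T6 + (F T7 + (F T8 + (F T9 + F T10))))))))).
Proof.
have tile_of_ord_bij : bijective tile_of_ord.
  exists ord_of_tile => [i | ]; last exact: ord_of_tileK.
  rewrite /ord_of_tile /tile_of_ord; apply: val_inj; rewrite /= inordK //.
    by case: i; do 11?[case=> //].
  by case: (nth _ _ _).
rewrite (reindex tile_of_ord); last exact: onW_bij.
by rewrite !big_ord_recl big_ord0 /tile_of_ord /= addn0.
Qed.

Lemma sum_tile (f : bool -> nat) t x y :
  \sum_(c : tile) [&& conn c Left == x, conn c Right == y & conn c Top == t]
                  * f (conn c Bottom) = tile_weight t x y * f (t (+) x (+) y).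
Proof.
by rewrite big_tile; case: t; case: x; case: y;
  rewrite /= ?mul0n ?mul1n ?addn0 ?add0n // !mulSn mul0n addn0.
Qed.

Lemma column_count m t e (a b : seq bool) : size a = m -> size b = m ->
  \sum_(c : m.-tuple tile)
     [&& left_conn c == a, right_conn c == b & vchained t c e]
  = (t (+) parity a (+) parity b == e) * column_weight t a b.
Proof.
elim: m t a b => [|m IHm] t [|x a] [|y b] //=.
  by rewrite big_tuple0 /vchained chained_nil /= muln1 !addbF.
move=> [sa] [sb]; rewrite big_tuple_cons.
transitivity (\sum_(c : tile)
    [&& conn c Left == x, conn c Right == y & conn c Top == t]
    * ((conn c Bottom (+) parity a (+) parity b == e)
       * column_weight (conn c Bottom) a b)).
  apply: eq_bigr => c _; rewrite -IHm // big_distrr /=.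
  apply: eq_bigr => u _; rewrite mulnb /vchained chained_cons /= !eqseq_cons.
  by do !case: (_ == _) => //=.
rewrite (sum_tile
  (fun d => (d (+) parity a (+) parity b == e) * column_weight d a b)).
rewrite mulnCA; congr ((_ == _) * _).
by case: t x y (parity a) (parity b) => [] [] [] [] [].
Qed.

(** * The transfer recursion for knot mosaics *)

(** The number of arrays of [n] fitting columns of height [m] with no connection
    point on the top, bottom and right boundary, and with left boundary state
    [a]. *)
Definition mosaic_count m n (a : seq bool) : nat :=
  \sum_(cs : n.-tuple (m.-tuple tile))
    (all (fun c : m.-tuple tile => vchained false c false) cs
     && hchained a (map val cs) (nseq m false)).

Lemma D_mosaic_count m n : 0 < m -> 0 < n ->
  D m n = mosaic_count m n (nseq m false).
Proof.
move=> m0 n0; rewrite /D -sum1_card big_mkcond /= /mosaic_count.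
rewrite (reindex (@column_mosaic m n)) /=; last exact/onW_bij/column_mosaic_bij.
by apply: eq_bigr => M _; rewrite inE -knot_mosaic_chained //.
Qed.

Lemma mosaic_count0 m a : mosaic_count m 0 a = (a == nseq m false).
Proof. by rewrite /mosaic_count big_tuple0 /hchained chained_nil. Qed.

Lemma mosaic_countS m n a : size a = m -> mosaic_count m n.+1 a =
  \sum_(b : m.-tuple bool)
    (parity a == parity b) * column_weight false a b * mosaic_count m n b.
Proof.
move=> sa; rewrite /mosaic_count big_tuple_cons.
transitivity (\sum_(c : m.-tuple tile) \sum_(b : m.-tuple bool)
   [&& left_conn c == a, right_conn c == b & vchained false c false]
   * mosaic_count m n b).
  apply: eq_bigr => c _.
  rewrite [RHS](bigD1 [tuple of right_conn c]) //= eqxx.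
  rewrite [X in _ = _ + X]big1 ?addn0; last first.
    move=> b; rewrite eq_sym -val_eqE /= => /negPf nb.
    by rewrite nb andbF.
  rewrite /mosaic_count big_distrr /=; apply: eq_bigr => u _.
  rewrite mulnb /hchained chained_cons.
  by do !case: (_ == _) => //=; rewrite ?andbF ?andbA.
rewrite exchange_big; apply: eq_bigr => b _; rewrite -big_distrl /=.
rewrite column_count ?size_tuple //; congr (_ * _ * _).
by case: (parity a) (parity b) => [] [].
Qed.

Lemma column_weight0l t a n : column_weight t (nseq n false) a = 1.
Proof.
by elim: n t a => [|n IHn] t [|x a] //=; rewrite IHn /tile_weight !andbF.
Qed.

Lemma column_weight0r t a n : column_weight t a (nseq n false) = 1.
Proof.
by elim: n t a => [|n IHn] t [|x a] //=; rewrite IHn /tile_weight !andbF.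
Qed.

Lemma column_weight_rcons t a b z w : size a = size b ->
  column_weight t (rcons a z) (rcons b w) =
  column_weight t a b * tile_weight (t (+) parity a (+) parity b) z w.
Proof.
elim: a b t => [|x a IHa] [|y b] //= t; first by rewrite muln1 mul1n !addbF.
case=> sab; rewrite IHa // mulnA; congr (_ * tile_weight _ _ _).
by case: t x y (parity a) (parity b) => [] [] [] [] [].
Qed.

Lemma parity_rcons a z : parity (rcons a z) = parity a (+) z.
Proof. by elim: a => [|x a IHa] /=; rewrite ?addbF // IHa addbA. Qed.

Lemma parity0 n : parity (nseq n false) = false.
Proof. by elim: n. Qed.

(** * Removing the boundary tiles *)

(** For [p], [q] positive, the number of suitably connected arrays with [p] rows
    and [q] columns and with left boundary state [a], the rest of the boundary
    being free: the two summands correspond to the connection on the top edge of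
    the first column. *)
Fixpoint inner_count p q (a : seq bool) : nat :=
  match q with
  | 0 => 1
  | q'.+1 =>
    \sum_(b : p.-tuple bool)
       (column_weight false a b + column_weight true a b) * inner_count p q' b
  end.

(** An even word of length [p.+2] is determined by its first bit and its [p]
    middle bits. *)
Lemma big_even_tuple p (F : p.+2.-tuple bool -> nat) :
  \sum_(b : p.+2.-tuple bool) (~~ parity b) * F b =
  \sum_(b : p.-tuple bool) \sum_(y : bool)
     F [tuple of y :: rcons b (y (+) parity b)].
Proof.
rewrite big_tuple_cons [RHS]exchange_big /=; apply: eq_bigr => y _.
rewrite big_tuple_rcons; apply: eq_bigr => b _.
rewrite (bigD1 (y (+) parity b)) //= big1 ?addn0 => [|w].
  rewrite parity_rcons (addbC y (parity b)) [parity b (+) (_ (+) _)]addbA.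
  by rewrite addbb addFb addbb mul1n.
by rewrite parity_rcons; case: y w (parity b) => [] [] [].
Qed.

(** A column without connections on its top and bottom edges preserves parity,
    so an odd left state never leads to the right state with no connection. *)
Lemma mosaic_count_odd m n a : size a = m -> parity a -> mosaic_count m n a = 0.
Proof.
elim: n a => [|n IHn] a sa par_a.
  by rewrite mosaic_count0; case: eqP par_a => // ->; rewrite parity0.
rewrite mosaic_countS // big1 // => b _; rewrite par_a.
by case: (boolP (parity b)) => [/(IHn _ (size_tuple b)) ->|]; rewrite ?muln0.
Qed.

(** Between even states, the top and bottom tiles of a column whose top edge has
    no connection point have weight 1, and the top edge of the inner part of the
    column is [x (+) y]. Indeed the top edge of the bottom tile has connection
    [z (+) w], so this tile cannot have connections on the left, right and top
    at once. *)
Lemma column_weight_even x a z y b w : size a = size b ->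
  ~~ parity (x :: rcons a z) -> ~~ parity (y :: rcons b w) ->
  column_weight false (x :: rcons a z) (y :: rcons b w)
  = column_weight (x (+) y) a b.
Proof.
move=> sab; rewrite /= !parity_rcons => par_a par_b.
rewrite column_weight_rcons // mulnCA /tile_weight mul1n.
by case: x y z w (parity a) (parity b) par_a par_b => [] [] [] [] [] [];
  rewrite //= muln1.
Qed.

(** The bit [x] plays no role on the right-hand side: changing it exchanges the
    contributions of the two values of the first bit of the next state. *)
Lemma mosaic_count_even p q x a z : size a = p -> ~~ parity (x :: rcons a z) ->
  mosaic_count p.+2 q.+1 (x :: rcons a z) = inner_count p q a.
Proof.
move=> sa par_a.
have sxaz : size (x :: rcons a z) = p.+2 by rewrite /= size_rcons sa.
elim: q x a z sa par_a sxaz => [|q IHq] x a z sa par_a sxaz.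
  (* The last column: its right state is empty, which leaves a single term. *)
  rewrite mosaic_countS ?sxaz // (bigD1 [tuple of nseq p.+2 false]) //.
  rewrite big1 ?addn0.
    rewrite mosaic_count0 eqxx muln1 column_weight0r muln1 parity0.
    by rewrite (negPf par_a).
  move=> b; rewrite -val_eqE => /= /negPf nb.
  by rewrite mosaic_count0 nb muln0.
rewrite mosaic_countS ?sxaz //.
transitivity (\sum_(b : p.+2.-tuple bool)
    (~~ parity b)
    * (column_weight false (x :: rcons a z) b * mosaic_count p.+2 q.+1 b)).
  apply: eq_bigr => b _; rewrite mulnA; congr (_ * _ * _).
  by rewrite (negPf par_a); case: parity.
rewrite big_even_tuple; apply: eq_bigr => b _.
have par_b y : ~~ parity (y :: rcons b (y (+) parity b)).
  by rewrite /= parity_rcons; case: y (parity b) => [] [].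
transitivity (\sum_(y : bool) column_weight (x (+) y) a b * inner_count p q b).
  apply: eq_bigr => y _.
  by rewrite column_weight_even ?IHq /= ?size_rcons ?sa ?size_tuple // par_b.
by rewrite -big_distrl big_bool /=; case: x {par_a sxaz}; rewrite // addnC.
Qed.

Lemma D_inner_count p q :
  D p.+2 q.+2 = 2 * \sum_(a : p.-tuple bool) inner_count p q a.
Proof.
rewrite D_mosaic_count // mosaic_countS ?size_nseq // parity0.
transitivity (\sum_(b : p.+2.-tuple bool)
    (~~ parity b) * mosaic_count p.+2 q.+1 b).
  by apply: eq_bigr => b _; rewrite column_weight0l muln1; case: parity.
rewrite big_even_tuple big_distrr /=; apply: eq_bigr => b _.
rewrite big_bool /= !mosaic_count_even ?size_tuple //= ?parity_rcons.
- by rewrite mul2n addnn.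
- by rewrite /=; case: parity.
- by rewrite /=; case: parity.
Qed.

(** * The matrices [Xmx] and [Omx] *)

(** The row or column of the matrices that corresponds to a state: the first bit
    selects the half of the block decomposition, the other bits the position in
    that half. *)
Fixpoint state_index k (a : seq bool) : 'I_(2 ^ k) :=
  match k with
  | 0 => ord0 : 'I_1
  | k'.+1 =>
    cast_ord (addnn_expn2 k')
      (if head false a then rshift (2 ^ k') (state_index k' (behead a))
       else lshift (2 ^ k') (state_index k' (behead a)))
  end.

Lemma state_index_bij k : bijective (fun a : k.-tuple bool => state_index k a).
Proof.
apply: inj_card_bij; last by rewrite card_ord card_tuple card_bool.
elim: k => [|k IHk] a b; first by rewrite (tuple0 a) (tuple0 b).
case/tupleP: a => x a; case/tupleP: b => y b /= /cast_ord_inj.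
case: x; case: y => E; [|move/eqP: E|move/eqP: E|];
  rewrite ?eq_rlshift ?eq_lrshift //.
  by rewrite (IHk _ _ (rshift_inj E)).
by rewrite (IHk _ _ (lshift_inj E)).
Qed.

Local Open Scope ring_scope.

Lemma Xmx_Omx_entries k (a b : seq bool) : size a = k -> size b = k ->
  Xmx k (state_index k a) (state_index k b) = (column_weight false a b)%:R
  /\ Omx k (state_index k a) (state_index k b) = (column_weight true a b)%:R.
Proof.
elim: k a b => [|k IHk] [|x a] [|y b] //=; first by rewrite !mxE.
move=> [sa] [sb]; have [EX EO] := IHk a b sa sb.
rewrite /block2 !castmxE !cast_ordK.
by case: x; case: y;
  rewrite ?block_mxEul ?block_mxEur ?block_mxEdl ?block_mxEdr /tile_weight ?mxE
   ?EX ?EO /= ?mul1n ?natrM.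
Qed.

Lemma row_sum_inner_count p q (a : p.-tuple bool) :
  \sum_j ((Xmx p + Omx p) ^+ q) (state_index p a) j = (inner_count p q a)%:R.
Proof.
elim: q a => [|q IHq] a /=.
  rewrite expr0 (bigD1 (state_index p a)) //= mxE eqxx big1 ?addr0 // => j.
  by rewrite mxE eq_sym => /negPf ->.
rewrite exprS natr_sum.
under eq_bigr do rewrite mxE.
rewrite exchange_big /= (reindex (fun b : p.-tuple bool => state_index p b)) /=;
  last exact/onW_bij/state_index_bij.
apply: eq_bigr => b _; rewrite -big_distrr /= IHq natrM mxE natrD.
by have [-> ->] := Xmx_Omx_entries (size_tuple a) (size_tuple b).
Qed.

Theorem theorem1 (m n : nat) (hm : (2 <= m)%N) (hn : (2 <= n)%N) :
  (D m n)%:Z = 2 * entry_sum ((Xmx (m - 2) + Omx (m - 2)) ^+ (n - 2)).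
Proof.
case: m hm => [|[|p]] // _; case: n hn => [|[|q]] // _.
rewrite D_inner_count !subSS !subn0 PoszM /entry_sum; congr (_ * _).
rewrite (reindex (fun a : p.-tuple bool => state_index p a)) /=;
  last exact/onW_bij/state_index_bij.
rewrite -natz natr_sum; apply: eq_bigr => a _.
by rewrite row_sum_inner_count.
Qed.
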